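(* Let $T_1,T_2:\mathbb{Z}\curvearrowright (X,\mu)$ be commuting probability-preserving actions on a standard Borel probability space and let $A\subset X$ be measurable with $\mu(A)>0$. Then \[\liminf_{N\to\infty}\frac{1}{N}\sum_{n=1}^N \mu(A\cap T_1^{-n}A\cap T_2^{-n}A) > 0.\]
   Context: Each probability-preserving action $T_i$ of $\mathbb{Z}$ is identified with the invertible measure-preserving transformation that generates it; $T_i^{n}$ denotes its $n$-th iterate. *)

(* Defs.v *)
From HB Require Import structures.
From mathcomp Require Import all_boot all_order all_algebra.
From mathcomp Require Import all_classical all_reals all_analysis.

Set Implicit Arguments.
Unset Strict Implicit.
Unset Printing Implicit Defensive.

Import Order.TTheory GRing.Theory Num.Theory.
Import numFieldNormedType.Exports.

Local Open Scope classical_set_scope.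
Local Open Scope ring_scope.

(* The library's bundled complete spaces are only pseudometric, so completeness
   of the metric is spelled out. *)
Definition Polish_metric (R : realType) (P : metricType R) : Prop :=
  (exists2 D : set P, countable D & dense D) /\
  (forall F : set_system P, ProperFilter F -> cauchy F -> exists p : P, F --> p).

(* The bijection f transports a Polish topology to X, whose measurable sets must
   be exactly the Borel sets of that topology. *)
Definition standard_Borel (R : realType) (d : measure_display)
    (X : measurableType d) : Prop :=
  exists (P : metricType R) (f : X -> P),
    [/\ Polish_metric P, bijective f
      & forall A : set X, measurable A <-> <<s @open P >> (f @` A)].

Record pp_Zaction (R : realType) (d : measure_display) (X : measurableType d)
    (mu : probability X R) := PpZaction {
  zact :> int -> X -> X ;
  zact0 : forall x, zact 0 x = x ;
  zactD : forall (m n : int) x, zact (m + n) x = zact m (zact n x) ;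
  measurable_zact : forall n : int, measurable_fun [set: X] (zact n) ;
  zact_preserving : forall (n : int) (A : set X),
    measurable A -> mu (zact n @^-1` A) = mu A }.

Definition commuting_actions (R : realType) (d : measure_display)
    (X : measurableType d) (mu : probability X R) (T1 T2 : pp_Zaction mu) : Prop :=
  forall (m n : int) (x : X), T1 m (T2 n x) = T2 n (T1 m x).

(* Main.v *)
Require Import Defs.
From HB Require Import structures.
From mathcomp Require Import all_boot all_order all_algebra.
From mathcomp Require Import all_classical all_reals all_analysis.
From mathcomp Require Import measurable_realfun ring lra zify.

Set Implicit Arguments.
Unset Strict Implicit.
Unset Printing Implicit Defensive.

Import Order.TTheory GRing.Theory Num.Theory.
Import numFieldNormedType.Exports.

Local Open Scope ring_scope.

(** Why the averages stay away from 0.  For a point [x] look at the finite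
    pattern of times [(a, b)] in [[0, N)^2] at which [T1^a T2^b x] lies in [A].
    If [T1^a T2^b x], [T1^(a+n) T2^b x] and [T1^a T2^(b+n) x] all lie in [A], then
    [T1^a T2^b x] is a point of [A] that returns to [A] at time [n] under both
    [T1] and [T2].  Such a triple of times is a corner of the pattern.  By
    invariance of [mu] the pattern has expected density [mu A], and the expected
    number of its corners with [1 <= n <= N] is at most [N^2] times the sum of
    the measures of the first [N] return sets.  So it is enough to know that a
    subset of [[0, N)^2] of density at least [delta] has at least [c N^3] corners
    with [n > 0], where [c] depends on [delta] only ([many_corners]).

    Dense planar sets have many corners because of triangle removal.  Take the
    vertical lines [x = a], the horizontal lines [y = b] and the antidiagonals
    [x + y = c] as vertices, and join two lines when they meet in the set.  A
    triangle is a corner, possibly of size 0 or of negative size; each point of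
    the set gives a triangle of size 0, and these triangles share no edge.  A
    graph on [n] vertices with [delta n^2] edge-disjoint triangles has at least
    [c n^3] triangles ([triangle_removal]), far more than the at most [n^2] of
    size 0.  To obtain a positive size the set is first intersected with its
    reflection in a well chosen point, which exchanges the two signs.

    Triangle removal follows from a regularity lemma ([regularity]): some
    partition of the vertices into boundedly many cells makes all but few pairs
    of vertices lie in cells between which the graph looks random, in the sense
    of the cut norm.  One of the edge-disjoint triangles avoids the irregular,
    sparse and small cells, and [counting_lemma] finds a positive proportion of
    triangles among its three cells.  The partition is obtained by energy
    increment: as long as there are many irregular pairs, adding the sets that
    witness irregularity increases the squared norm of the conditional
    expectation of the edge indicator by a fixed amount, and that norm is
    bounded. *)

(** * Conditional expectation on a finite space *)

Section CondExp.
Variables (R : realFieldType) (W : finType) (K : eqType).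
Implicit Types (k : W -> K) (f g : W -> R).

Definition fiber k w : {set W} := [set v | k v == k w].

(** The fibres of [k] play the role of the atoms of a sigma-algebra, for the
    uniform measure. *)
Definition condexp k f w : R := (\sum_(v in fiber k w) f v) / #|fiber k w|%:R.

Lemma card_fiber_gt0 k w : 0 < #|fiber k w|%:R :> R.
Proof. by rewrite ltr0n; apply/card_gt0P; exists w; rewrite inE. Qed.

Lemma fiber_eq k v w : k v = k w -> fiber k v = fiber k w.
Proof. by move=> e; apply/setP=> u; rewrite !inE e. Qed.

Lemma condexp_eq k f v w : k v = k w -> condexp k f v = condexp k f w.
Proof. by move=> e; rewrite /condexp (fiber_eq e). Qed.

(** Conditional expectation is self-adjoint and fixes the functions that are
    constant on fibres. *)
Lemma sum_condexpM k f g :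
  (forall v w, k v = k w -> g v = g w) ->
  \sum_w condexp k f w * g w = \sum_w f w * g w.
Proof.
move=> gk.
transitivity (\sum_w \sum_(v in fiber k w) f v * g v / #|fiber k v|%:R).
  apply: eq_bigr => w _; rewrite /condexp mulrAC mulr_suml mulr_suml.
  apply: eq_bigr => v; rewrite inE => /eqP e.
  by rewrite (gk _ _ e) (fiber_eq e).
rewrite (exchange_big_dep predT) //=; apply: eq_bigr => v _.
rewrite (eq_bigl (mem (fiber k v))); last by move=> w; rewrite !inE eq_sym.
rewrite sumr_const -[RHS](@mulfVK _ #|fiber k v|%:R) ?gt_eqF ?card_fiber_gt0 //.
by rewrite mulr_natr.
Qed.

Lemma sum_condexp k f : \sum_w condexp k f w = \sum_w f w.
Proof.
have := @sum_condexpM k f (fun=> 1) (fun _ _ _ => erefl).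
by under eq_bigr do rewrite mulr1; under [in RHS]eq_bigr do rewrite mulr1.
Qed.

Lemma condexp_ge0 k f w : (forall v, 0 <= f v) -> 0 <= condexp k f w.
Proof. by move=> f0; rewrite divr_ge0 ?ler0n ?sumr_ge0. Qed.

Lemma condexp_le1 k f w : (forall v, f v <= 1) -> condexp k f w <= 1.
Proof.
move=> f1; rewrite ler_pdivrMr ?card_fiber_gt0 // mul1r -sumr_const.
exact: ler_sum.
Qed.

Definition energy k f : R := \sum_w condexp k f w ^+ 2.

Lemma energy_le k f :
  (forall w, 0 <= f w) -> (forall w, f w <= 1) -> energy k f <= #|W|%:R.
Proof.
move=> f0 f1; rewrite -sum1_card natr_sum; apply: ler_sum => w _.
by rewrite expr_le1 ?condexp_ge0 ?condexp_le1.
Qed.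

End CondExp.

(** The coarse expectation is the orthogonal projection of the fine one, so the
    energy gained by refining a partition is the squared distance between the
    two. *)
Lemma energy_pythagoras (R : realFieldType) (W : finType) (K K' : eqType)
    (k : W -> K) (k' : W -> K') (f : W -> R) :
  (forall v w, k' v = k' w -> k v = k w) ->
  \sum_w (condexp k' f w - condexp k f w) ^+ 2 = energy k' f - energy k f.
Proof.
move=> kk'.
have cross : \sum_w condexp k' f w * condexp k f w = energy k f.
  rewrite sum_condexpM; last by move=> v w /kk'; apply: condexp_eq.
  rewrite -(sum_condexpM f (condexp_eq f (k := k))).
  by apply: eq_bigr => w _; rewrite expr2.
transitivity (energy k' f - 2 * energy k f + energy k f); last by ring.
rewrite -{1}cross mulr_sumr /energy -sumrB -big_split /=.
by apply: eq_bigr => w _; ring.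
Qed.

(** * Partitions generated by families of sets, and irregular pairs *)

Section Cells.
Variable V : finType.
Implicit Types (L : {set {set V}}) (x y : V).

Definition trace L x : {set {set V}} := [set A in L | x \in A].

(** Partitions are given by a family of generating sets, so that refining a
    partition just means enlarging the family. *)
Definition cell L x : {set V} := fiber (trace L) x.

Lemma trace_subset L L' x y :
  L \subset L' -> trace L' x = trace L' y -> trace L x = trace L y.
Proof.
move=> /fintype.subsetP LL' /setP e; apply/setP=> A; have := e A; rewrite !inE.
by case AL: (A \in L) => //; rewrite LL'.
Qed.

Lemma trace_mem L x y A : A \in L -> trace L x = trace L y -> (x \in A) = (y \in A).
Proof. by move=> AL /setP/(_ A); rewrite !inE AL. Qed.

Definition cells L : {set {set V}} := [set cell L x | x in V].

Lemma card_cells L : (#|cells L| <= 2 ^ #|L|)%N.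
Proof.
rewrite -card_powerset.
pose F (S : {set {set V}}) := [set y | trace L y == S].
apply: leq_trans (leq_imset_card F _); apply: subset_leq_card; apply/fintype.subsetP=> C.
case/imsetP=> x _ ->; apply/imsetP; exists (trace L x) => //.
by rewrite inE; apply/fintype.subsetP=> A; rewrite inE => /andP[].
Qed.

End Cells.

Section Density.
Variables (R : realFieldType) (V : finType).
Implicit Types (f : V -> V -> R) (A B C D : {set V}) (L : {set {set V}}).

Definition sum2 f A B : R := \sum_(x in A) \sum_(y in B) f x y.

Definition density f A B : R := sum2 f A B / (#|A|%:R * #|B|%:R).

Lemma sum2_density f A B : sum2 f A B = density f A B * (#|A|%:R * #|B|%:R).
Proof.
rewrite /density; have [|nz] := eqVneq (#|A|%:R * #|B|%:R : R) 0; last by rewrite divfK.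
move=> z; rewrite z mulr0; move/eqP: z; rewrite mulf_eq0 !pnatr_eq0 !cards_eq0 /sum2.
case/orP=> /eqP->; first by rewrite big_set0.
by apply: big1 => x _; rewrite big_set0.
Qed.

Definition key2 L (p : V * V) := (trace L p.1, trace L p.2).

Lemma fiber_key2 L p q :
  (q \in fiber (key2 L) p) = (q.1 \in cell L p.1) && (q.2 \in cell L p.2).
Proof. by rewrite !inE xpair_eqE. Qed.

Lemma sum_fiber_key2 L p f :
  \sum_(q in fiber (key2 L) p) f q.1 q.2 = sum2 f (cell L p.1) (cell L p.2).
Proof.
by rewrite /sum2 pair_big; apply: eq_bigl => q; rewrite fiber_key2.
Qed.

Lemma card_fiber_key2 L p :
  #|fiber (key2 L) p| = (#|cell L p.1| * #|cell L p.2|)%N.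
Proof.
rewrite -finset.cardsX; apply: fintype.eq_card => -[a b].
by rewrite fiber_key2 finset.in_setX.
Qed.

Lemma condexp_key2 L f p :
  condexp (key2 L) (fun q => f q.1 q.2) p = density f (cell L p.1) (cell L p.2).
Proof. by rewrite /condexp sum_fiber_key2 card_fiber_key2 natrM. Qed.

(** The pair [A], [B] shows that [f] is not within [eps] of a constant on
    [C * D] in cut norm.  Measuring the deviation against the size of [C * D],
    and not against that of [A * B], also discards small witnesses. *)
Definition deviates f (eps : R) C D A B :=
  [&& A \subset C, B \subset D &
      eps * (#|C|%:R * #|D|%:R) <
        `|sum2 (fun x y => f x y - density f C D) A B|].

Definition irregular f eps C D :=
  [exists A : {set V}, [exists B : {set V}, deviates f eps C D A B]].

(** The refined expectation has the same sum as [f] over [A * B], while the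
    coarse one is constant there; so a deviation of [f] forces the two to differ
    in mean square. *)
Lemma energy_increment_cell L L' f eps p A B :
  0 < eps -> L \subset L' -> A \in L' -> B \in L' ->
  deviates f eps (cell L p.1) (cell L p.2) A B ->
  eps ^+ 2 <=
    condexp (key2 L) (fun q => (condexp (key2 L') (fun q => f q.1 q.2) q
                               - condexp (key2 L) (fun q => f q.1 q.2) q) ^+ 2) p.
Proof.
move=> e0 LL' AL BL /and3P[AC BD dev].
set C := cell L p.1 in AC dev *; set D := cell L p.2 in BD dev *.
set F' := condexp (key2 L') _; set F := condexp (key2 L) (fun q => f q.1 q.2).
set AB := [set q : V * V | (q.1 \in A) && (q.2 \in B)].
have ABf : AB \subset fiber (key2 L) p.
  apply/fintype.subsetP=> q; rewrite inE fiber_key2 => /andP[qA qB].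
  by rewrite (fintype.subsetP AC) // (fintype.subsetP BD).
have FE q : q \in AB -> F q = density f C D.
  move=> /(fintype.subsetP ABf); rewrite inE => /eqP e.
  by rewrite /F (condexp_eq _ e); exact: condexp_key2.
have sumE : \sum_(q in AB) (F' q - F q) = sum2 (fun x y => f x y - density f C D) A B.
  rewrite sumrB [X in _ - X](eq_bigr (fun=> density f C D)) => [|q qAB]; last exact: FE.
  have -> : \sum_(q in AB) F' q = \sum_(q in AB) f q.1 q.2.
    pose g q : R := (q \in AB)%:R.
    have red h : \sum_(q in AB) h q = \sum_q h q * g q.
      rewrite big_mkcond; apply: eq_bigr => q _.
      by rewrite /g; case: ifP; rewrite ?(mulr1, mulr0).
    rewrite !red; apply: (sum_condexpM (fun q => f q.1 q.2)) => v w [e1 e2].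
    by rewrite /g !inE (trace_mem AL e1) (trace_mem BL e2).
  rewrite -sumrB /sum2 pair_big /=.
  by apply: eq_bigl => q; rewrite inE.
have n0 : 0 < #|fiber (key2 L) p|%:R :> R by exact: card_fiber_gt0.
have -> : condexp (key2 L) (fun q => (F' q - F q) ^+ 2) p =
  (\sum_(q in fiber (key2 L) p) (F' q - F q) ^+ 2) / #|fiber (key2 L) p|%:R by [].
rewrite ler_pdivlMr //; set n := #|fiber _ _|%:R in n0 *.
have -> : n = #|C|%:R * #|D|%:R by rewrite /n card_fiber_key2 natrM.
set S := sum2 _ A B in dev sumE.
pose l := eps * Num.sg S.
have lS : l * S = eps * `|S| by rewrite /l -mulrA normrEsg.
have l2 : l ^+ 2 <= eps ^+ 2.
  rewrite /l exprMn sqr_sg ler_piMr ?sqr_ge0 //.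
  by rewrite lern1 leq_b1.
(* Cauchy-Schwarz, in the linearised form h^2 >= 2 l h - l^2. *)
have low : \sum_(q in AB) (2 * l * (F' q - F q) - l ^+ 2) <=
           \sum_(q in fiber (key2 L) p) (F' q - F q) ^+ 2.
  apply: (@le_trans _ _ (\sum_(q in AB) (F' q - F q) ^+ 2)).
    apply: ler_sum => q _.
    by rewrite -subr_ge0 (_ : _ - _ = (F' q - F q - l) ^+ 2) ?sqr_ge0 //; ring.
  rewrite big_mkcond [leRHS]big_mkcond; apply: ler_sum => q _ /=.
  by case: ifP => [/(fintype.subsetP ABf)-> //|_]; case: ifP => // _; rewrite sqr_ge0.
apply: le_trans low.
rewrite sumrB -mulr_sumr sumE.
rewrite -(mulrA 2 l S) lS sumr_const -[X in _ - X]mulr_natr.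
have ABn : #|AB|%:R <= #|C|%:R * #|D|%:R :> R.
  by rewrite -natrM -card_fiber_key2 ler_nat subset_leq_card.
have : l ^+ 2 * #|AB|%:R <= eps ^+ 2 * (#|C|%:R * #|D|%:R).
  by apply: ler_pM; rewrite ?sqr_ge0.
have : eps * (eps * (#|C|%:R * #|D|%:R)) <= eps * `|S| by rewrite ler_pM2l // ltW.
move: (#|C|%:R * #|D|%:R) => m; move: (l ^+ 2 * _) => u; lra.
Qed.

End Density.

(** * The regularity lemma *)

Section Regularity.
Variables (R : realFieldType) (I V : finType).
Implicit Types (f : I -> V -> V -> R) (L : {set {set V}}).

Lemma exists_witness_refinement f eps L :
  exists L', [/\ L \subset L',
    (#|L'| <= #|L| + 2 * #|I| * 4 ^ #|L|)%N &
    forall i x y, irregular (f i) eps (cell L x) (cell L y) ->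
      exists A B, [/\ A \in L', B \in L' &
        deviates (f i) eps (cell L x) (cell L y) A B]].
Proof.
(* A witness is chosen for each pair of cells, not for each pair of points:
   this is what bounds the number of new sets. *)
pose w (t : I * ({set V} * {set V})) : {set V} * {set V} :=
  odflt (finset.set0, finset.set0)
    [pick AB | deviates (f t.1) eps t.2.1 t.2.2 AB.1 AB.2].
pose idx : {set I * ({set V} * {set V})} :=
  finset.setX (finset.setTfor I) (finset.setX (cells L) (cells L)).
exists (L :|: ([set (w t).1 | t in idx] :|: [set (w t).2 | t in idx])); split.
- exact: finset.subsetUl.
- apply: leq_trans (leq_card_setU _ _) _; rewrite leq_add2l.
  apply: leq_trans (leq_card_setU _ _) _.
  have idxle : (#|idx| <= #|I| * 4 ^ #|L|)%N.
    rewrite !finset.cardsX finset.cardsT leq_mul2l (_ : 4 = 2 * 2)%N // expnMn.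
    by rewrite leq_mul ?orbT ?card_cells.
  by rewrite -mulnA mul2n -addnn leq_add // (leq_trans (leq_imset_card _ _)).
- move=> i x y irr; pose t := (i, (cell L x, cell L y)).
  have tidx : t \in idx.
    by rewrite !finset.in_setX finset.in_setT /= !imset_f.
  exists (w t).1, (w t).2; split.
  + by rewrite !finset.inE (imset_f (fun t => (w t).1)) ?orbT.
  + by rewrite !finset.inE (imset_f (fun t => (w t).2)) ?orbT.
  + rewrite /w; case: pickP => //= none.
    have /existsP[A /existsP[B dev]] := irr.
    by have := none (A, B); rewrite /= dev.
Qed.

Definition irregular_pairs (f1 : V -> V -> R) eps L : {set V * V} :=
  [set p | irregular f1 eps (cell L p.1) (cell L p.2)].

Definition total_energy f L : R :=
  \sum_i energy (key2 L) (fun p => f i p.1 p.2).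

Lemma total_energy_le f L :
  (forall i x y, 0 <= f i x y) -> (forall i x y, f i x y <= 1) ->
  total_energy f L <= #|I|%:R * #|V|%:R ^+ 2.
Proof.
move=> f0 f1; rewrite -sum1_card natr_sum mulr_suml; apply: ler_sum => i _.
rewrite mul1r expr2 -natrM -fintype.card_prod; exact: energy_le.
Qed.

(** Averaging the gain of [energy_increment_cell] over the irregular pairs. *)
Lemma energy_increment f eps L : 0 < eps ->
  exists L', (#|L'| <= #|L| + 2 * #|I| * 4 ^ #|L|)%N /\
    total_energy f L + eps ^+ 2 * (\sum_i #|irregular_pairs (f i) eps L|%:R)
      <= total_energy f L'.
Proof.
move=> e0; have [L' [LL' cL' wit]] := exists_witness_refinement f eps L.
exists L'; split=> //; rewrite -lerBrDl -sumrB mulr_sumr; apply: ler_sum => i _.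
rewrite -energy_pythagoras; last first.
  by move=> v w [/(trace_subset LL') e /(trace_subset LL') e']; congr pair.
rewrite -(sum_condexp (key2 L)) -sum1_card natr_sum mulr_sumr big_mkcond.
apply: ler_sum => p _; rewrite finset.inE; case: ifP => [irr|_]; last first.
  by apply: condexp_ge0 => q; rewrite sqr_ge0.
have [A [B [AL BL dev]]] := wit _ _ _ irr.
rewrite mulr1; exact: energy_increment_cell dev.
Qed.

End Regularity.

(** Size of the generating family after [n] refinements for [k] functions. *)
Definition regularity_bound (k n : nat) : nat :=
  iter n (fun m => m + 2 * k * 4 ^ m)%N 0%N.

(** The energy is at most [#|I| * #|V|^2], and each refinement of a partition
    that is not yet regular adds [eps^2 * eta * #|V|^2] to it, so a number of
    refinements that depends only on [#|I|], [eps] and [eta] is enough. *)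
Lemma regularity (R : archiRealFieldType) (I : finType) (eps eta : R) :
  0 < eps -> 0 < eta ->
  exists K : nat, forall (V : finType) (f : I -> V -> V -> R),
    (forall i x y, 0 <= f i x y) -> (forall i x y, f i x y <= 1) ->
    exists L : {set {set V}}, (#|L| <= K)%N /\
      forall i, #|irregular_pairs (f i) eps L|%:R <= eta * #|V|%:R ^+ 2.
Proof.
move=> e0 h0.
have g0 : 0 < eps ^+ 2 * eta by rewrite mulr_gt0 ?exprn_gt0.
pose n := Num.bound (#|I|%:R / (eps ^+ 2 * eta)).
have nP : #|I|%:R < n%:R * (eps ^+ 2 * eta).
  by rewrite -ltr_pdivrMr // archi_boundP // divr_ge0 ?ler0n ?ltW.
have mono m : (regularity_bound #|I| m <= regularity_bound #|I| m.+1)%N.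
  exact: leq_addr.
exists (regularity_bound #|I| n) => V f f0 f1.
set good := fun L : {set {set V}} =>
  forall i, #|irregular_pairs (f i) eps L|%:R <= eta * #|V|%:R ^+ 2.
have [V0|V0] := posnP #|V|.
  exists finset.set0; split; first by rewrite cards0.
  move=> i; rewrite V0 expr0n mulr0 lern0 eq_card0 // => p.
  by have := fintype.card0_eq V0 p.1.
have step m : (exists L : {set {set V}}, (#|L| <= regularity_bound #|I| m)%N /\ good L) \/
  (exists L : {set {set V}}, (#|L| <= regularity_bound #|I| m)%N /\
     m%:R * (eps ^+ 2 * eta) * #|V|%:R ^+ 2 <= total_energy f L).
  elim: m => [|m [[L [cL gL]]|[L [cL eL]]]].
  - right; exists finset.set0; rewrite cards0 !mul0r; split=> //.
    by apply: sumr_ge0 => i _; apply: sumr_ge0 => p _; rewrite sqr_ge0.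
  - by left; exists L; split=> //; apply: leq_trans (mono m).
  have [/forallP gL|] := boolP
    [forall i, #|irregular_pairs (f i) eps L|%:R <= eta * #|V|%:R ^+ 2].
    by left; exists L; split=> //; apply: leq_trans (mono m).
  rewrite negb_forall => /existsP[i]; rewrite -ltNge => bad.
  have [L' [cL' eL']] := energy_increment f L e0.
  right; exists L'; split.
    apply: leq_trans cL' _; rewrite /= leq_add // leq_mul2l.
    by rewrite leq_pexp2l ?orbT.
  apply: le_trans eL'; rewrite -natr1 mulrDl mulrDl lerD // mul1r -mulrA.
  rewrite ler_wpM2l ?sqr_ge0 // (bigD1 i) //= (le_trans (ltW bad)) //.
  by rewrite lerDl sumr_ge0.
have [[L [cL gL]]|[L [cL eL]]] := step n; first by exists L.
have := le_trans eL (total_energy_le L f0 f1).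
by rewrite ler_pM2r ?exprn_gt0 ?ltr0n // leNgt nP.
Qed.

(** * Counting and removing triangles *)

Section Triangles.
Variables (R : realFieldType) (V : finType).
Implicit Types (e : rel V) (C D : {set V}) (L : {set {set V}}).

Definition indicator e x y : R := (e x y)%:R.

Lemma density_indicator_ge0 e C D : 0 <= density (indicator e) C D.
Proof.
by rewrite divr_ge0 ?mulr_ge0 ?ler0n // sumr_ge0 // => x _; rewrite sumr_ge0.
Qed.

Lemma density_indicator_le1 e C D : density (indicator e) C D <= 1.
Proof.
have [z|nz] := eqVneq (#|C|%:R * #|D|%:R : R) 0.
  by rewrite /density z invr0 mulr0.
rewrite ler_pdivrMr ?lt_def ?nz ?mulr_ge0 // mul1r -natrM mulnC natrM.
rewrite mulr_natr -sumr_const; apply: ler_sum => x _.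
rewrite -sumr_const; apply: ler_sum => y _; by rewrite lern1 leq_b1.
Qed.

Lemma sum2_setIdE (g : V -> V -> R) C D (P Q : pred V) :
  sum2 g [set x in C | P x] [set y in D | Q y] =
  \sum_(x in C) \sum_(y in D) g x y * ((P x)%:R * (Q y)%:R).
Proof.
rewrite /sum2; rewrite big_mkcond [RHS]big_mkcond; apply: eq_bigr => x _.
rewrite finset.inE; case: (x \in C) => //=; case: (P x); last first.
  by rewrite big1 // => y _; rewrite mul0r mulr0.
rewrite big_mkcond [RHS]big_mkcond; apply: eq_bigr => y _.
rewrite finset.inE mul1r; case: (y \in D) => //=.
by case: (Q y); rewrite ?mulr1 ?mulr0.
Qed.

Lemma regular_sum2 (f : V -> V -> R) eps C D (P Q : pred V) :
  ~~ irregular f eps C D ->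
  `|\sum_(x in C) \sum_(y in D) (f x y - density f C D) * ((P x)%:R * (Q y)%:R)|
    <= eps * (#|C|%:R * #|D|%:R).
Proof.
rewrite leNgt; apply: contra => dev.
apply/existsP; exists [set x in C | P x]; apply/existsP; exists [set y in D | Q y].
rewrite /deviates sum2_setIdE dev andbT.
by apply/andP; split; apply/fintype.subsetP => x; rewrite finset.inE => /andP[].
Qed.

(** Replace the edge indicators by their densities one after the other.  With
    one vertex fixed, the other two indicators restrict the sum to a rectangle,
    over which regularity bounds the error.  After two replacements the sum over
    the third indicator is exactly its density times the size. *)
Lemma counting_lemma e0 e1 e2 eps C0 C1 C2 :
  ~~ irregular (indicator e0) eps C0 C1 ->
  ~~ irregular (indicator e1) eps C1 C2 ->
  (density (indicator e0) C0 C1 * density (indicator e1) C1 C2 *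
     density (indicator e2) C0 C2 - 2 * eps) *
    (#|C0|%:R * #|C1|%:R * #|C2|%:R) <=
  \sum_(x in C0) \sum_(y in C1) \sum_(z in C2)
    indicator e0 x y * indicator e1 y z * indicator e2 x z.
Proof.
move=> r0 r1.
set d0 := density _ C0 C1; set d1 := density _ C1 C2; set d2 := density _ C0 C2.
pose F0 x y z := (indicator e0 x y - d0) * ((e2 x z)%:R * (e1 y z)%:R).
pose F1 x y z := d0 * ((indicator e1 y z - d1) * (true%:R * (e2 x z)%:R)).
pose F2 x (y : V) z := d0 * d1 * indicator e2 x z.
have -> : \sum_(x in C0) \sum_(y in C1) \sum_(z in C2)
    indicator e0 x y * indicator e1 y z * indicator e2 x z =
  (\sum_(x in C0) \sum_(y in C1) \sum_(z in C2) F0 x y z) +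
  (\sum_(x in C0) \sum_(y in C1) \sum_(z in C2) F1 x y z) +
  (\sum_(x in C0) \sum_(y in C1) \sum_(z in C2) F2 x y z).
  rewrite -!big_split; apply: eq_bigr => x _ /=.
  rewrite -!big_split; apply: eq_bigr => y _ /=.
  rewrite -!big_split; apply: eq_bigr => z _ /=.
  rewrite /F0 /F1 /F2 /indicator mul1r.
  by move: (e0 x y)%:R (e1 y z)%:R (e2 x z)%:R => a b c; ring.
have b0 : `|\sum_(x in C0) \sum_(y in C1) \sum_(z in C2) F0 x y z|
    <= eps * (#|C0|%:R * #|C1|%:R * #|C2|%:R).
  have -> : \sum_(x in C0) \sum_(y in C1) \sum_(z in C2) F0 x y z =
    \sum_(z in C2) \sum_(x in C0) \sum_(y in C1) F0 x y z.
    by rewrite [RHS]exchange_big; apply: eq_bigr => x _; rewrite exchange_big.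
  apply: le_trans (ler_norm_sum _ _ _) _.
  rewrite mulrA mulr_natr -sumr_const; apply: ler_sum => z _.
  exact: regular_sum2 r0.
have b1 : `|\sum_(x in C0) \sum_(y in C1) \sum_(z in C2) F1 x y z|
    <= eps * (#|C0|%:R * #|C1|%:R * #|C2|%:R).
  apply: le_trans (ler_norm_sum _ _ _) _.
  have -> : eps * (#|C0|%:R * #|C1|%:R * #|C2|%:R) =
      \sum_(x in C0) eps * (#|C1|%:R * #|C2|%:R).
    by rewrite sumr_const -[RHS]mulr_natr; ring.
  apply: ler_sum => x _.
  under eq_bigr do rewrite -mulr_sumr.
  rewrite -mulr_sumr normrM ger0_norm ?density_indicator_ge0 // mulrC.
  apply: le_trans (regular_sum2 predT (e2 x) r1).
  by rewrite ler_piMr ?density_indicator_le1.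
have -> : \sum_(x in C0) \sum_(y in C1) \sum_(z in C2) F2 x y z =
    d0 * d1 * d2 * (#|C0|%:R * #|C1|%:R * #|C2|%:R).
  have -> : \sum_(x in C0) \sum_(y in C1) \sum_(z in C2) F2 x y z =
      d0 * d1 * #|C1|%:R * sum2 (indicator e2) C0 C2.
    rewrite /sum2 mulr_sumr; apply: eq_bigr => x _.
    rewrite /F2 sumr_const -mulr_natr -mulr_sumr; ring.
  by rewrite sum2_density -/d2; ring.
move: b0 b1; rewrite !ler_norml => /andP[b0 _] /andP[b1 _]; rewrite mulrBl.
by move: b0 b1; set m := _ * _ * #|C2|%:R; lra.
Qed.

(** Few edges lie in sparse pairs of cells: the number of such edges is the sum
    over those pairs of the conditional expectation of the edge indicator. *)
Lemma sparse_pairs e L (a : R) : 0 <= a ->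
  #|[set p : V * V | e p.1 p.2 &&
      (density (indicator e) (cell L p.1) (cell L p.2) < a)]|%:R
    <= a * #|V|%:R ^+ 2.
Proof.
move=> a0; pose d p := density (indicator e) (cell L p.1) (cell L p.2).
have dE p : condexp (key2 L) (fun q => indicator e q.1 q.2) p = d p.
  exact: condexp_key2.
pose s p : R := (d p < a)%R%:R.
have -> : #|[set p : V * V | e p.1 p.2 && (d p < a)%R]|%:R =
    \sum_p indicator e p.1 p.2 * s p.
  rewrite -sum1_card natr_sum big_mkcond; apply: eq_bigr => p _.
  by rewrite finset.inE /indicator /s; case: (e _ _); case: (d p < a); rewrite ?(mul1r, mul0r).
rewrite -(@sum_condexpM _ _ _ (key2 L)); last first.
  by move=> v w e'; rewrite /s -!dE (condexp_eq _ e').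
rewrite expr2 -natrM -fintype.card_prod -sum1_card natr_sum mulr_sumr.
apply: ler_sum => p _; rewrite dE mulr1 /s.
by case: ltP => [/ltW|_]; rewrite ?mulr1 ?mulr0.
Qed.

Lemma small_cells L (g : R) : 0 <= g ->
  #|[set x | #|cell L x|%:R < g]|%:R <= g * 2 ^+ #|L|.
Proof.
move=> g0; pose P := [set C in cells L | #|C|%:R < g].
have sub : [set x | #|cell L x|%:R < g] \subset finset.cover P.
  apply/fintype.subsetP => x; rewrite finset.inE => xs.
  apply/finset.bigcupP; exists (cell L x); first by rewrite finset.inE imset_f.
  by rewrite finset.inE.
have : (#|[set x | (#|cell L x|%:R < g)%R]| <= \sum_(C in P) #|C|)%N.
  exact: leq_trans (subset_leq_card sub) (finset.leq_card_cover _).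
rewrite -(ler_nat R) => /le_trans; apply; rewrite natr_sum.
apply: (@le_trans _ _ (\sum_(C in P) g)).
  by apply: ler_sum => C; rewrite finset.inE => /andP[_ /ltW].
rewrite sumr_const -[leLHS]mulr_natr ler_wpM2l // -natrX ler_nat.
apply: leq_trans (card_cells L); apply: subset_leq_card.
by apply/fintype.subsetP => C; rewrite finset.inE => /andP[].
Qed.

End Triangles.

Definition triangles (V : finType) (e0 e1 e2 : rel V) : {set V * V * V} :=
  [set t | [&& e0 t.1.1 t.1.2, e1 t.1.2 t.2 & e2 t.1.1 t.2]].

Lemma leq_card_inj_on (S T : finType) (A : {set S}) (B : {set T}) (h : S -> T) :
  {in A &, injective h} -> (forall s, s \in A -> h s \in B) -> (#|A| <= #|B|)%N.
Proof.
move=> inj AB; rewrite -(card_in_imset inj); apply: subset_leq_card.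
by apply/fintype.subsetP => _ /imsetP[s sA ->]; exact: AB.
Qed.

Lemma card_preim_inj (S T : finType) (A : {set S}) (B : {set T}) (h : S -> T) :
  {in A &, injective h} -> (#|[set s in A | h s \in B]| <= #|B|)%N.
Proof.
move=> inj; apply: (@leq_card_inj_on _ _ _ _ h) => [s t|s].
  rewrite !finset.inE => /andP[sA _] /andP[tA _]; exact: inj.
by rewrite finset.inE => /andP[].
Qed.

Definition edge_disjoint (V : finType) (S : {set V * V * V}) : Prop :=
  [/\ {in S &, injective (fun t => (t.1.1, t.1.2))},
      {in S &, injective (fun t => (t.1.2, t.2))} &
      {in S &, injective (fun t => (t.1.1, t.2))}].

Lemma sum_indicator_triangles (R : realFieldType) (V : finType) (e0 e1 e2 : rel V)
    (C0 C1 C2 : {set V}) :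
  \sum_(x in C0) \sum_(y in C1) \sum_(z in C2)
    indicator R e0 x y * indicator R e1 y z * indicator R e2 x z
  <= #|triangles e0 e1 e2|%:R.
Proof.
rewrite pair_big pair_big /= -sum1_card natr_sum [leLHS]big_mkcond [leRHS]big_mkcond.
apply: ler_sum => -[[x y] z] _ /=; rewrite !finset.inE /indicator /=.
case: (e0 x y); case: (e1 y z); case: (e2 x z);
  rewrite /= ?(mul0r, mulr0, mulr1); by case: ifP.
Qed.

(** Since the triangles of [S] are edge-disjoint, a set of pairs spoils at most
    as many of them as it has elements.  The irregular, sparse and small pairs
    are fewer than [#|S|], and a triangle of [S] that none of them spoils lies in
    three cells with a positive proportion of triangles. *)
Lemma triangle_removal (R : archiRealFieldType) (del : R) : 0 < del ->
  exists2 c : R, 0 < c &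
    forall (V : finType) (e0 e1 e2 : rel V) (S : {set V * V * V}),
      S \subset triangles e0 e1 e2 ->
      edge_disjoint S ->
      del * #|V|%:R ^+ 2 <= #|S|%:R ->
      c * #|V|%:R ^+ 3 <= #|triangles e0 e1 e2|%:R.
Proof.
(* Eight kinds of bad pairs, each at most del / 9 of all pairs. *)
move=> del0; pose a := del / 9; have a0 : 0 < a by rewrite divr_gt0.
pose eps := a ^+ 3 / 4; have eps0 : 0 < eps by rewrite divr_gt0 // exprn_gt0.
have [K regK] := regularity bool eps0 a0.
pose g := a / 2 ^+ K; have g0 : 0 < g by rewrite divr_gt0 // exprn_gt0.
exists (a ^+ 3 / 2 * g ^+ 3); first by rewrite mulr_gt0 ?divr_gt0 ?exprn_gt0.
move=> V e0 e1 e2 S ST [inj01 inj12 inj02] cardS.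
have [V0|V0] := posnP #|V|; first by rewrite V0 expr0n mulr0 ler0n.
pose n : R := #|V|%:R; have n0 : 0 < n by rewrite ltr0n.
pose f (b : bool) := indicator R (if b then e0 else e1).
have f_ge0 b x y : 0 <= f b x y by rewrite ler0n.
have f_le1 b x y : f b x y <= 1 by rewrite lern1 leq_b1.
have [L [cL regL]] := regK V f f_ge0 f_le1.
pose sparse e := [set p : V * V | e p.1 p.2 &&
      (density (indicator R e) (cell L p.1) (cell L p.2) < a)].
pose small : {set V} := [set x | #|cell L x|%:R < g * n].
have irr0 := regL true; have irr1 := regL false; rewrite /= in irr0 irr1.
have sp e : #|sparse e|%:R <= a * n ^+ 2 by apply: sparse_pairs; exact: ltW.
have sm : #|small|%:R <= a * n.
  apply: le_trans (small_cells L _) _; first by rewrite mulr_ge0 ?ltW.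
  rewrite mulrAC ler_wpM2r ?(ltW n0) // /g -mulrA ler_piMr ?(ltW a0) //.
  by rewrite mulrC ler_pdivrMr ?exprn_gt0 // mul1r ler_eXn2l ?ltr1n.
pose B0 := irregular_pairs (f true) eps L :|: sparse e0.
pose B1 := irregular_pairs (f false) eps L :|: sparse e1.
pose B2 := sparse e2.
pose smalll := finset.setX small (finset.setTfor V).
pose smallr := finset.setX (finset.setTfor V) small.
pose P0 := [set t in S | (t.1.1, t.1.2) \in (B0 :|: smalll) :|: smallr].
pose P1 := [set t in S | (t.1.2, t.2) \in B1 :|: smallr].
pose P2 := [set t in S | (t.1.1, t.2) \in B2].
have [/existsP[[[x y] z] /andP[tS]]|none] :=
  boolP [exists t, (t \in S) && (t \notin (P0 :|: P1) :|: P2)].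
  have := fintype.subsetP ST _ tS; rewrite !finset.inE /= => /and3P[xy yz xz].
  rewrite tS xy yz xz /= !negb_or -!leNgt => /andP[/andP[]].
  move=> /andP[/andP[/andP[r0 d0] /andP[sx _]] sy] /andP[/andP[r1 d1] sz] d2.
  apply: le_trans (sum_indicator_triangles R e0 e1 e2 (cell L x) (cell L y) (cell L z)).
  apply: le_trans (counting_lemma e2 r0 r1).
  rewrite (_ : _ * _ = a ^+ 3 / 2 * (g * n * (g * n) * (g * n))); last by rewrite -/n; ring.
  have gn0 : 0 <= g * n by rewrite mulr_ge0 ?ltW.
  have a0' := ltW a0; have g0' := ltW g0; have n0' := ltW n0; have del0' := ltW del0.
  apply: ler_pM; rewrite ?mulr_ge0 ?invr_ge0 ?exprn_ge0 //; last first.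
    by apply: ler_pM => //; [exact: mulr_ge0|exact: ler_pM].
  have : a * a * a <= density (indicator R e0) (cell L x) (cell L y) *
     density (indicator R e1) (cell L y) (cell L z) *
     density (indicator R e2) (cell L x) (cell L z).
    by apply: ler_pM => //; [exact: mulr_ge0|exact: ler_pM].
  by rewrite /eps; lra.
have cover : S \subset (P0 :|: P1) :|: P2.
  apply/fintype.subsetP => t St; apply: contraR none => tP.
  by apply/existsP; exists t; rewrite St.
have U (T : finType) (A B : {set T}) : #|A :|: B|%:R <= #|A|%:R + #|B|%:R :> R.
  by rewrite -natrD ler_nat leq_card_setU.
have P0le : #|P0|%:R <= a * n ^+ 2 + a * n ^+ 2 + a * n ^+ 2 + a * n ^+ 2.
  have := card_preim_inj ((B0 :|: smalll) :|: smallr) inj01.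
  rewrite -(ler_nat R) => /le_trans; apply.
  apply: le_trans (U _ _ _) _; apply: lerD; last first.
    by rewrite finset.cardsX finset.cardsT natrM mulrC -/n expr2 mulrA ler_wpM2r ?(ltW n0).
  apply: le_trans (U _ _ _) _; apply: lerD; last first.
    by rewrite finset.cardsX finset.cardsT natrM -/n expr2 mulrA ler_wpM2r ?(ltW n0).
  by apply: le_trans (U _ _ _) _; apply: lerD.
have P1le : #|P1|%:R <= a * n ^+ 2 + a * n ^+ 2 + a * n ^+ 2.
  have := card_preim_inj (B1 :|: smallr) inj12.
  rewrite -(ler_nat R) => /le_trans; apply.
  apply: le_trans (U _ _ _) _; apply: lerD; last first.
    by rewrite finset.cardsX finset.cardsT natrM mulrC -/n expr2 mulrA ler_wpM2r ?(ltW n0).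
  by apply: le_trans (U _ _ _) _; apply: lerD.
have P2le : #|P2|%:R <= a * n ^+ 2.
  have := card_preim_inj B2 inj02.
  rewrite -(ler_nat R) => /le_trans; apply; exact: sp.
have : #|S|%:R <= #|P0|%:R + #|P1|%:R + #|P2|%:R :> R.
  apply: (@le_trans _ _ #|(P0 :|: P1) :|: P2|%:R).
    by rewrite ler_nat subset_leq_card.
  by apply: le_trans (U _ _ _) _; rewrite lerD2r.
have delE : del = 9 * a by rewrite /a mulrC divfK.
have an0 : 0 < a * n ^+ 2 by rewrite mulr_gt0 ?exprn_gt0.
move: cardS P0le P1le P2le; rewrite -/n delE -mulrA; lra.
Qed.

(** * Corners in dense planar sets *)

Section Corners.
Variable N : nat.
Implicit Types F : nat -> nat -> bool.
Local Notation V := 'I_(2 * N).+1.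

Definition in_box F := forall a b, F a b -> (a < N)%N && (b < N)%N.

Definition points F : {set V * V} := [set p : V * V | F p.1 p.2].

(** Adjacency of horizontal lines and antidiagonals. *)
Definition row_diag F : rel V := fun b c => (b <= c)%N && F (c - b)%N b.
(** Adjacency of vertical lines and antidiagonals. *)
Definition col_diag F : rel V := fun a c => (a <= c)%N && F a (c - a)%N.

Definition corner_triangles F : {set V * V * V} :=
  triangles (fun a b : V => F a b) (row_diag F) (col_diag F).

(** The entry [t.2] encodes a corner of size [t.2 + 1], so only positive sizes
    occur. *)
Definition corners F : {set V * V * V} :=
  [set t : V * V * V | [&& F t.1.1 t.1.2, F (t.1.1 + t.2.+1)%N t.1.2 &
               F t.1.1 (t.1.2 + t.2.+1)%N]].

(** The intersection of [F] with its image under [(a, b) |-> (u - a, w - b)]. *)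
Definition reflected F u w a b :=
  [&& F a b, (a <= u)%N, (b <= w)%N & F (u - a)%N (w - b)%N].

(** Three lines through a common point of [F] form a triangle; two of them
    determine the point, hence the third line. *)
Lemma edge_disjoint_corner_triangles F : in_box F ->
  exists S : {set V * V * V}, [/\ S \subset corner_triangles F, edge_disjoint S &
    (#|points F| <= #|S|)%N].
Proof.
move=> box.
pose S := [set t : V * V * V | (t.1.1 + t.1.2 == t.2)%N && F t.1.1 t.1.2].
exists S; split; [|split|].
- apply/fintype.subsetP => -[[a b] c']; rewrite !finset.inE /= => /andP[/eqP e Fab].
  by rewrite /row_diag /col_diag -e leq_addr leq_addl addnK addKn Fab.
- move=> [[a b] c'] [[a' b'] c'']; rewrite !finset.inE /=.
  move=> /andP[/eqP e _] /andP[/eqP e' _] [ea eb]; move: e'; rewrite -ea -eb e => e'.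
  by congr (_, _, _); apply: val_inj.
- move=> [[a b] c'] [[a' b'] c'']; rewrite !finset.inE /=.
  move=> /andP[/eqP e _] /andP[/eqP e' _] [eb ec]; subst b' c''.
  by congr (_, _, _); apply: val_inj => /=; lia.
- move=> [[a b] c'] [[a' b'] c'']; rewrite !finset.inE /=.
  move=> /andP[/eqP e _] /andP[/eqP e' _] [eb ec]; subst a' c''.
  by congr (_, _, _); apply: val_inj => /=; lia.
- apply: (@leq_card_inj_on _ _ _ _ (fun p : V * V => (p, inord (p.1 + p.2)%N))).
    by move=> p q _ _ [].
  move=> [a b]; rewrite !finset.inE /= => Fab; have /andP[aN bN] := box _ _ Fab.
  by rewrite inordK ?eqxx //; lia.
Qed.

(** Pairs of points of [F] are classified by their sum [(u, w)]; pigeonhole. *)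
Lemma exists_dense_reflection F : in_box F ->
  exists u w : V, (#|points F| ^ 2 <= #|V| ^ 2 * #|points (reflected F u w)|)%N.
Proof.
move=> box.
pose Q := [set t : (V * V) * (V * V) | t.2 \in points (reflected F t.1.1 t.1.2)].
have le1 : (#|points F| ^ 2 <= #|Q|)%N.
  rewrite -mulnn -finset.cardsX.
  apply: (@leq_card_inj_on _ _ _ _ (fun s : (V * V) * (V * V) =>
    ((inord (s.1.1 + s.2.1)%N, inord (s.1.2 + s.2.2)%N), s.1))).
    move=> [[a b] [a' b']] [[a1 b1] [a1' b1']].
    rewrite !finset.in_setX !finset.inE /=.
    move=> /andP[/box/andP[? ?] /box/andP[? ?]] /andP[/box/andP[? ?] /box/andP[? ?]].
    case=> /(congr1 val) /= e1 /(congr1 val) /= e2 ea eb; subst a1 b1.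
    move: e1 e2; rewrite !inordK; try lia.
    by move=> e1 e2; congr (_, (_, _)); apply: val_inj => /=; lia.
  move=> [[a b] [a' b']]; rewrite !finset.in_setX !finset.inE /=.
  move=> /andP[Fab Fab']; have /andP[? ?] := box _ _ Fab; have /andP[? ?] := box _ _ Fab'.
  rewrite /reflected !inordK; try lia.
  by rewrite Fab !leq_addr !addKn.
have le2 : (#|Q| <= \sum_(v : V * V) #|points (reflected F v.1 v.2)|)%N.
  under [X in (_ <= X)%N]eq_bigr do rewrite -sum1_card.
  rewrite pair_big_dep /= -sum1_card; apply: eq_leq.
  by apply: eq_bigl => t; rewrite finset.inE.
have [v vP] : exists v : V * V, forall v' : V * V,
    (#|points (reflected F v'.1 v'.2)| <= #|points (reflected F v.1 v.2)|)%N.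
  exists [arg max_(v > (ord0, ord0) : V * V) #|points (reflected F v.1 v.2)|].
  by case: arg_maxnP => // v _ vP v'; exact: vP.
exists v.1, v.2; apply: leq_trans le1 (leq_trans le2 _).
rewrite -mulnn -fintype.card_prod -sum_nat_const; apply: leq_sum => v' _; exact: vP.
Qed.

(** A triangle is a corner of size [c - a - b].  There are at most [#|V|^2]
    triangles of size 0, the positive sizes give corners of [F], and the
    reflection turns the negative ones into corners of [F] of positive size. *)
Lemma corner_triangles_le F u w : in_box F ->
  (#|corner_triangles (reflected F u w)| <= #|V| ^ 2 + 2 * #|corners F|)%N.
Proof.
move=> box; set T := corner_triangles _.
pose T0 := [set t in T | (t.1.1 + t.1.2 == t.2)%N].
pose T1 := [set t in T | (t.1.1 + t.1.2 < t.2)%N].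
pose T2 := [set t in T | (t.2 < t.1.1 + t.1.2)%N].
have split : T \subset T0 :|: (T1 :|: T2).
  apply/fintype.subsetP => t tT; rewrite !finset.inE; rewrite finset.inE in tT.
  by rewrite tT /=; case: ltngtP.
have TP (a b c : V) : (a, b, c) \in T -> [/\ reflected F u w a b,
    (b <= c)%N /\ reflected F u w (c - b)%N b & (a <= c)%N /\ reflected F u w a (c - a)%N].
  by rewrite finset.inE => /and3P[-> /andP[-> ->] /andP[-> ->]].
have T0le : (#|T0| <= #|V| ^ 2)%N.
  rewrite -mulnn -fintype.card_prod -finset.cardsT.
  apply: (@leq_card_inj_on _ _ _ _ (fun t : V * V * V => t.1)) => //.
  move=> [[a b] c] [[a' b'] c'].
  rewrite finset.inE => /andP[_ /eqP /= e]; rewrite finset.inE => /andP[_ /eqP /= e'].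
  case=> ea eb; subst a' b'.
  by congr pair; apply: val_inj; rewrite /= -e -e'.
have T1le : (#|T1| <= #|corners F|)%N.
  apply: (@leq_card_inj_on _ _ _ _ (fun t : V * V * V =>
    (t.1.1, t.1.2, inord (t.2 - (t.1.1 + t.1.2)).-1%N))).
    move=> [[a b] c] [[a' b'] c']; have := ltn_ord c; have := ltn_ord c'.
    rewrite finset.inE => ? ? /andP[_ /= lt] ; rewrite finset.inE => /andP[_ /= lt'].
    case=> ea eb /(congr1 val) /=; subst a' b'; rewrite !inordK; try lia.
    by move=> e; congr pair; apply: val_inj => /=; lia.
  move=> [[a b] c]; have := ltn_ord c; rewrite finset.inE => ? /andP[/TP[]] /= .
  move=> /and4P[Fab _ _ _] [bc /and4P[Fb _ _ _]] [ac /and4P[Fa _ _ _]] lt.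
  rewrite finset.inE /= inordK; last by lia.
  rewrite Fab (_ : a + _ = c - b)%N ?Fb; last by lia.
  by rewrite (_ : b + _ = c - a)%N ?Fa; last by lia.
have T2le : (#|T2| <= #|corners F|)%N.
  apply: (@leq_card_inj_on _ _ _ _ (fun t : V * V * V =>
    (inord (u - t.1.1)%N, inord (w - t.1.2)%N, inord (t.1.1 + t.1.2 - t.2).-1%N))).
    move=> [[a b] c] [[a' b'] c'].
    rewrite finset.inE => /andP[/TP[/= /and4P[/box/andP[? ?] ? ? /box/andP[? ?]] _ _] lt].
    rewrite finset.inE => /andP[/TP[/= /and4P[/box/andP[? ?] ? ? /box/andP[? ?]] _ _] lt'].
    case=> /(congr1 val) /= e1 /(congr1 val) /= e2 /(congr1 val) /= e3.
    move: e1 e2 e3; rewrite !inordK; try lia.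
    by move=> e1 e2 e3; congr (_, _, _); apply: val_inj => /=; lia.
  move=> [[a b] c]; rewrite finset.inE => /andP[/TP[]] /=.
  move=> /and4P[Fab au bw Fab'] [bc /and4P[Fb ? ? Fb']] [ac /and4P[Fa ? ? Fa']] lt.
  have ua : (u - a < (2 * N).+1)%N by move/box/andP: Fab' => [aN _]; clear -aN; lia.
  have wb : (w - b < (2 * N).+1)%N by move/box/andP: Fab' => [_ bN]; clear -bN; lia.
  have k : ((a + b - c).-1 < (2 * N).+1)%N.
    by move/box/andP: Fab => [aN bN]; clear -aN bN; lia.
  have eu : (u - a + (a + b - c).-1.+1 = u - (c - b))%N by clear -au bc lt; lia.
  have ew : (w - b + (a + b - c).-1.+1 = w - (c - a))%N by clear -bw ac lt; lia.
  by rewrite finset.inE /= !inordK // Fab' eu Fb' ew Fa'.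
apply: leq_trans (subset_leq_card split) _.
apply: leq_trans (leq_card_setU _ _) _; apply: leq_add => //.
by apply: leq_trans (leq_card_setU _ _) _; rewrite (mul2n #|corners F|) -addnn leq_add.
Qed.

End Corners.

Lemma sum_bool_card (R : pzSemiRingType) (T : finType) (P : pred T) :
  \sum_t (P t)%:R = #|[set t | P t]|%:R :> R.
Proof.
rewrite -sum1_card natr_sum [RHS]big_mkcond; apply: eq_bigr => t _.
by rewrite finset.inE; case: (P t).
Qed.

(** The threshold [N0] ensures that the triangles of size 0 make up at most half
    of those found by [triangle_removal]. *)
Lemma many_corners (R : archiRealFieldType) (del : R) : 0 < del ->
  exists2 c : R, 0 < c & exists N0 : nat,
    forall (N : nat) (E : nat -> nat -> bool), (N0 <= N)%N ->
      del * N%:R ^+ 2 <= \sum_(a < N) \sum_(b < N) (E a b)%:R ->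
      c * N%:R ^+ 3 <= \sum_(a < N) \sum_(b < N) \sum_(n < N)
        [&& E a b, E (a + n.+1)%N b & E a (b + n.+1)%N]%:R.
Proof.
move=> del0; have del9 : 0 < (del / 9) ^+ 2 by rewrite exprn_gt0 ?divr_gt0.
have [c c0 rem] := triangle_removal del9.
exists (c / 4); first by rewrite divr_gt0.
exists (Num.bound (2 / c)).+1 => N E N0N dense.
have N1 : (0 < N)%N by apply: leq_trans N0N.
pose F a b := [&& (a < N)%N, (b < N)%N & E a b].
have box : in_box N F by move=> a b /and3P[-> ->].
pose v : R := #|'I_(2 * N).+1|%:R.
have vE : v = 2 * N%:R + 1 by rewrite /v card_ord -natr1 natrM.
have N1R : 1 <= N%:R :> R by rewrite ler1n.
have NleV : N%:R <= v by rewrite vE; lra.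
have Vle3N : v <= 3 * N%:R by rewrite vE; lra.
have v0 : 0 < v by lra.
have NV : (N <= (2 * N).+1)%N by rewrite leqW // leq_pmull.
have pts_ge : del * N%:R ^+ 2 <= #|points N F|%:R.
  apply: le_trans dense _; rewrite pair_big /= sum_bool_card ler_nat.
  apply: (@leq_card_inj_on _ _ _ _ (fun p => (widen_ord NV p.1, widen_ord NV p.2))).
    by move=> [a b] [a' b'] _ _ [ea eb]; congr pair; apply: val_inj.
  by move=> [a b]; rewrite !finset.inE /F /= !ltn_ord.
have pts_dense : del / 9 * v ^+ 2 <= #|points N F|%:R.
  apply: le_trans pts_ge.
  rewrite -mulrA ler_wpM2l ?(ltW del0) // ler_pdivrMl //.
  apply: (@le_trans _ _ ((3 * N%:R) ^+ 2)); last by lra.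
  by rewrite ler_sqr ?nnegrE ?mulr_ge0 // ltW.
have [u [w refl]] := exists_dense_reflection box.
pose G := reflected F u w.
have boxG : in_box N G by move=> a b /and4P[/box].
have G_dense : (del / 9) ^+ 2 * v ^+ 2 <= #|points N G|%:R.
  rewrite -(ler_pM2l (exprn_gt0 2 v0)).
  apply: (@le_trans _ _ (#|points N F|%:R ^+ 2)); last first.
    by rewrite /v -!natrX -natrM ler_nat.
  rewrite (_ : v ^+ 2 * _ = (del / 9 * v ^+ 2) ^+ 2); last by ring.
  by rewrite ler_sqr ?nnegrE // mulr_ge0 ?divr_ge0 ?exprn_ge0 // ltW.
have [S [ST disj GS]] := edge_disjoint_corner_triangles boxG.
have tri : c * v ^+ 3 <= #|corner_triangles N G|%:R.
  by apply: rem ST disj _; apply: le_trans G_dense _; rewrite ler_nat.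
have := corner_triangles_le u w box; rewrite -(ler_nat R) natrD natrM natrX -/v.
move=> /(le_trans tri) cnt.
have cv2 : 2 <= c * v.
  rewrite -ler_pdivrMl // mulrC (le_trans _ NleV) // ltW //.
  have : 2 / c < (Num.bound (2 / c))%:R by rewrite archi_boundP // divr_ge0 // ltW.
  by move=> /lt_le_trans; apply; rewrite ler_nat ltnW.
have cor : c / 4 * v ^+ 3 <= #|corners N F|%:R.
  have : 2 * v ^+ 2 <= c * v * v ^+ 2 by rewrite ler_wpM2r ?exprn_ge0 ?(ltW v0).
  by rewrite -mulrA -exprS; move: cnt; lra.
apply: (@le_trans _ _ (c / 4 * v ^+ 3)).
  by rewrite ler_wpM2l ?divr_ge0 ?(ltW c0) // lerXn2r ?nnegrE ?ler0n ?(ltW v0).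
apply: le_trans cor _.
rewrite pair_big pair_big /= sum_bool_card ler_nat.
pose h (t : 'I_N * 'I_N * 'I_N) :=
  (widen_ord NV t.1.1, widen_ord NV t.1.2, widen_ord NV t.2).
apply: leq_trans (leq_imset_card h _); apply: subset_leq_card.
apply/fintype.subsetP => -[[a b] n].
rewrite finset.inE /= => /and3P[/and3P[aN bN Eab] /and3P[anN _ Ea] /and3P[_ _ Eb]].
have nN : (n < N)%N by exact: ltnW (leq_ltn_trans (leq_addl a n.+1) anN).
apply/imsetP; exists (Ordinal aN, Ordinal bN, Ordinal nN).
  by rewrite finset.inE /= Eab Ea.
by congr (_, _, _); apply: val_inj.
Qed.

(** * Transference to the measure space *)

Local Open Scope classical_set_scope.
Local Open Scope ring_scope.
Local Open Scope ereal_scope.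

Lemma limn_einf_ge (R : realType) (u : (\bar R)^nat) (l : \bar R) (N0 : nat) :
  (forall N, (N0 <= N)%N -> l <= u N) -> l <= limn_einf u.
Proof.
move=> lu; rewrite limn_einf_lim; apply: lime_ge; first exact: is_cvg_einfs.
exists N0 => // n /= N0n; apply: le_ereal_inf_tmp => _ [p /= np] <-.
by apply: lu; apply: leq_trans N0n np.
Qed.

Section Recurrence.
Variables (R : realType) (d : measure_display) (X : measurableType d).
Variables (mu : probability X R) (T1 T2 : pp_Zaction mu).

Definition joint (a b : nat) (x : X) : X := T1 a%:Z (T2 b%:Z x).

Definition return_set (A : set X) (n : nat) : set X :=
  A `&` (T1 n%:Z @^-1` A) `&` (T2 n%:Z @^-1` A).

Lemma measurable_zact_preimage (T : pp_Zaction mu) (n : int) (A : set X) :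
  measurable A -> measurable (T n @^-1` A).
Proof.
by move=> mA; rewrite -[_ @^-1` _]setTI; apply: measurable_zact.
Qed.

Lemma measurable_joint a b (A : set X) :
  measurable A -> measurable (joint a b @^-1` A).
Proof.
by move=> mA; exact: measurable_zact_preimage (measurable_zact_preimage T1 _ mA).
Qed.

Lemma joint_preserving a b (A : set X) :
  measurable A -> mu (joint a b @^-1` A) = mu A.
Proof.
move=> mA; rewrite -[RHS](zact_preserving T1 a%:Z) //.
rewrite -[RHS](zact_preserving T2 b%:Z) //; exact: measurable_zact_preimage.
Qed.

Lemma measurable_return_set A n : measurable A -> measurable (return_set A n).
Proof. by move=> mA; do ?apply: measurableI => //; exact: measurable_zact_preimage. Qed.

Lemma integral_sum_joint (J : finType) (a b : J -> nat) (B : J -> set X) :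
  (forall j, measurable (B j)) ->
  \int[mu]_x (\sum_j (\1_(joint (a j) (b j) @^-1` B j) x)%:E) = \sum_j mu (B j).
Proof.
move=> mB; have mj j := measurable_joint (a j) (b j) (mB j).
rewrite ge0_integral_sum //.
- by apply: eq_bigr => j _; rewrite integral_indic // setIT; exact: joint_preserving.
- by move=> j; apply/measurable_EFinP; exact: measurable_indic.
Qed.

(** Commutation turns the three points of a corner into a point and its images
    under [T1^n] and [T2^n]. *)
Lemma mem_joint_return A a b n x : commuting_actions T1 T2 ->
  (x \in joint a b @^-1` return_set A n) =
  [&& joint a b x \in A, joint (a + n) b x \in A & joint a (b + n) x \in A].
Proof.
move=> T12; have e1 : joint (a + n) b x = T1 n%:Z (joint a b x).
  by rewrite /joint addnC PoszD zactD.
have e2 : joint a (b + n) x = T2 n%:Z (joint a b x).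
  by rewrite /joint addnC PoszD zactD T12.
rewrite e1 e2; apply/idP/and3P; rewrite !in_setE; first by case=> [[]].
by case.
Qed.

(** Integrate the pointwise bound [gh], which says that the pattern of [x] has
    many corners unless it is sparse; patterns below half of the expected density
    contribute at most half of the expected number of points. *)
Lemma sum_return_sets_ge (A : set X) :
  commuting_actions T1 T2 -> measurable A -> 0 < mu A ->
  exists2 k : R, (0 < k)%R & exists N0 : nat, forall N, (N0 <= N)%N ->
    (k * N%:R)%:E <= \sum_(1 <= n < N.+1) mu (return_set A n).
Proof.
move=> T12 mA A0; pose m := fine (mu A).
have mE (B : set X) : measurable B -> mu B = (fine (mu B))%:E.
  by move=> mB; rewrite fineK // fin_num_measure.
have m0 : (0 < m)%R by rewrite -lte_fin -mE.
have [c c0 [N0 cor]] := many_corners (divr_gt0 m0 (ltr0n R 2)).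
exists (c * (m / 2))%R; first by rewrite !mulr_gt0 ?invr_gt0.
exists N0.+1 => N N0N; have N1 : (0 < N)%N by apply: leq_ltn_trans N0N.
have NR : (0 < N%:R :> R)%R by rewrite ltr0n.
pose r n := fine (mu (return_set A n)).
have rE n : mu (return_set A n) = (r n)%:E.
  by rewrite mE //; exact: measurable_return_set.
pose J2 : finType := ('I_N * 'I_N)%type; pose J3 : finType := ('I_N * 'I_N * 'I_N)%type.
pose g x : R := (\sum_(p : J2) \1_(joint p.1 p.2 @^-1` A) x)%R.
pose h x : R :=
  (\sum_(t : J3) \1_(joint t.1.1 t.1.2 @^-1` return_set A t.2.+1) x)%R.
have gh x : (c * N%:R * g x <= h x + c * N%:R ^+ 3 * (m / 2))%R.
  have h0 : (0 <= h x)%R by apply: sumr_ge0 => t _.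
  pose E a b := joint a b x \in A.
  have gE : g x = (\sum_(a < N) \sum_(b < N) (E a b)%:R)%R.
    by rewrite pair_big; apply: eq_bigr => p _; rewrite indicE.
  have hE : h x = (\sum_(a < N) \sum_(b < N) \sum_(n < N)
        [&& E a b, E (a + n.+1)%N b & E a (b + n.+1)%N]%:R)%R.
    rewrite pair_big pair_big; apply: eq_bigr => t _.
    by rewrite indicE mem_joint_return.
  have gN : (g x <= N%:R ^+ 2)%R.
    have -> : (N%:R ^+ 2 = \sum_(p : J2) 1 :> R)%R.
      by rewrite sumr_const fintype.card_prod card_ord natrM.
    by apply: ler_sum => p _; rewrite indicE lern1 leq_b1.
  have [dense|sparse] := leP (m / 2 * N%:R ^+ 2)%R (g x).
    have := cor N (fun a b => E a b) (ltnW N0N); rewrite -gE -hE => /(_ dense) ch.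
    have : (c * N%:R * g x <= c * N%:R * N%:R ^+ 2)%R by rewrite ler_wpM2l // mulr_ge0 // ltW.
    have : (0 <= c * N%:R ^+ 3 * (m / 2))%R by rewrite !mulr_ge0 ?exprn_ge0 ?invr_ge0 // ltW.
    rewrite (_ : c * N%:R * N%:R ^+ 2 = c * N%:R ^+ 3)%R; last by ring.
    by lra.
  have : (c * N%:R * g x <= c * N%:R * (m / 2 * N%:R ^+ 2))%R.
    by rewrite ler_wpM2l ?mulr_ge0 ?(ltW c0) // ltW.
  rewrite (_ : c * N%:R * (m / 2 * N%:R ^+ 2) = c * N%:R ^+ 3 * (m / 2))%R; last by ring.
  by lra.
have int_gh : (c * N%:R * (N%:R ^+ 2 * m) <=
    N%:R ^+ 2 * (\sum_(n < N) r n.+1) + c * N%:R ^+ 3 * (m / 2))%R.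
  have mA1 (p : J2) : measurable A by [].
  have mB (t : J3) : measurable (return_set A t.2.+1) by exact: measurable_return_set.
  have ig := integral_sum_joint (fun p : J2 => p.1) (fun p : J2 => p.2) mA1.
  have ih := integral_sum_joint (fun t : J3 => t.1.1) (fun t : J3 => t.1.2) mB.
  have mg : measurable_fun setT (EFin \o g).
    apply/measurable_EFinP; apply: measurable_sum => p.
    by apply: measurable_indic; exact: measurable_joint.
  have mh : measurable_fun setT (EFin \o h).
    apply/measurable_EFinP; apply: measurable_sum => p.
    by apply: measurable_indic; exact: measurable_joint.
  have g0 x : 0 <= (g x)%:E by rewrite lee_fin sumr_ge0.
  have h0 x : 0 <= (h x)%:E by rewrite lee_fin sumr_ge0.
  have cN0 : (0 <= c * N%:R)%R by rewrite mulr_ge0 ?(ltW c0).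
  pose K : R := (c * N%:R ^+ 3 * (m / 2))%R.
  have K0 : 0 <= K%:E by rewrite lee_fin !mulr_ge0 ?exprn_ge0 ?invr_ge0 // ltW.
  have : \int[mu]_x ((c * N%:R)%:E * (g x)%:E) <= \int[mu]_x ((h x)%:E + (cst K%:E x)).
    apply: ge0_le_integral => //.
    - by move=> x _; rewrite mule_ge0.
    - exact: measurable_funeM.
    - exact: emeasurable_funD.
    - by move=> x _; rewrite -EFinM -EFinD lee_fin gh.
  rewrite ge0_integralZl_EFin // ge0_integralD // integral_cst //.
  have -> : \int[mu]_x (g x)%:E = (N%:R ^+ 2 * m)%:E.
    under eq_integral do rewrite -sumEFin.
    rewrite ig mE // -/m sumEFin sumr_const fintype.card_prod card_ord.
    by rewrite -[in LHS]mulr_natl natrM.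
  have -> : \int[mu]_x (h x)%:E = (N%:R ^+ 2 * \sum_(n < N) r n.+1)%:E.
    under eq_integral do rewrite -sumEFin.
    rewrite ih; under eq_bigr do rewrite rE.
    rewrite sumEFin -(pair_big predT predT (fun (p : J2) (n : 'I_N) => r n.+1)) /=.
    by rewrite sumr_const fintype.card_prod card_ord -[in LHS]mulr_natl natrM.
  rewrite [X in _ + _ * X](_ : _ = 1); last exact: probability_setT.
  by rewrite mule1 -EFinM -EFinD lee_fin.
rewrite big_add1 /= big_mkord; under eq_bigr do rewrite rE.
rewrite sumEFin lee_fin -(ler_pM2l (exprn_gt0 2 NR)); move: int_gh.
by set s := (\sum_(n < N) _)%R; lra.
Qed.

End Recurrence.

Theorem theorem3p2 (R : realType) (d : measure_display) (X : measurableType d)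
    (mu : probability X R) (T1 T2 : pp_Zaction mu) (A : set X) :
  standard_Borel R X ->
  commuting_actions T1 T2 ->
  measurable A ->
  0 < mu A ->
  0 < limn_einf (fun N : nat => (N%:R^-1)%:E *
        \sum_(1 <= n < N.+1)
          mu (A `&` (T1 n%:Z @^-1` A) `&` (T2 n%:Z @^-1` A))).
Proof.
move=> _ T12 mA A0; have [k k0 [N0 ge]] := sum_return_sets_ge T12 mA A0.
apply: (@lt_le_trans _ _ k%:E); first by rewrite lte_fin.
apply: (@limn_einf_ge _ _ _ N0.+1) => N N0N.
have N1 : (0 < N%:R :> R)%R by rewrite ltr0n (leq_ltn_trans _ N0N).
rewrite -lee_pdivrMl ?invr_gt0 // invrK -EFinM mulrC.
exact: ge (ltnW N0N).
Qed.
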